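(* Let $S=\mathrm{diag}(s_1,s_2,s_3)$ be a real diagonal matrix with $0<s_1<s_2<s_3$ and $s_1+s_2+s_3=1$. Then $\mathcal L_{MN}(S)\subset\mathcal L(S)$.
   Context: Throughout, $S=\mathrm{diag}(s_1,s_2,s_3)$ with $0<s_1<s_2<s_3$, $s_1+s_2+s_3=1$. Diagonal matrices $\mathrm{diag}(a_1,a_2,a_3)$ are identified with points $(a_1,a_2,a_3)\in\mathbb R^3$. Both sets below lie in the plane $\{m_1+m_2+m_3=1\}$. **The set $\mathcal L_{MN}(S)$.** Let $v_\alpha=\frac{s_2}{2s_2+s_3}$, $v_\beta=\frac{s_2}{2s_2+s_1}$, $V_\alpha=(v_\alpha,v_\alpha,1-2v_\alpha)$, $V_\beta=(1-2v_\beta,v_\beta,v_\beta)$. $\mathcal L_{MN}(S)$ is the union of the images, under all permutations of the three coordinates, of the (closed) quadrilateral with consecutive vertices $(s_1,s_2,s_3)$, $V_\alpha$, $(\frac13,\frac13,\frac13)$, $V_\beta$. **The set $\mathcal L(S)$.** Let $u_\alpha$ and $u_\beta$ be the smallest and greatest roots, respectively, of $$H(x)=6s_2x^2+x(s_1s_3-3s_2-4s_2^2)+2s_2^2 ,$$ and set $U_\alpha=\mathrm{diag}(u_\alpha,u_\alpha,1-2u_\alpha)$, $U_\beta=\mathrm{diag}(1-2u_\beta,u_\beta,u_\beta)$, $\alpha=u_\alpha/s_2$, $\beta=u_\beta/s_2$. For $\gamma\in\{\alpha,\beta\}$ let $\varphi_\gamma$ be an angle with $$\cos(2\varphi_\gamma)=\frac{2s_2(3s_2-1)+u_\gamma(1+s_1^2-9s_2^2-2s_1s_3+s_3^2)}{2(s_3-s_1)(s_2-u_\gamma)},$$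 and let $\theta_\alpha,\theta_\beta$ be angles with $$\cos(2\theta_\alpha)=\frac{u_\alpha(s_3-s_1)+(u_\alpha-s_2)\cos(2\varphi_\alpha)}{s_2(1-3u_\alpha)},\qquad \cos(2\theta_\beta)=\frac{u_\beta(s_1-s_3)+(s_2-u_\beta)\cos(2\varphi_\beta)}{s_2(1-3u_\beta)}.$$ Let $$R_\alpha=\begin{pmatrix}0&-1&0\\-\cos\theta_\alpha&0&\sin\theta_\alpha\\-\sin\theta_\alpha&0&-\cos\theta_\alpha\end{pmatrix},\qquad R_\beta=\begin{pmatrix}\cos\theta_\beta&0&-\sin\theta_\beta\\ \sin\theta_\beta&0&\cos\theta_\beta\\0&-1&0\end{pmatrix}.$$ For $\gamma\in\{\alpha,\beta\}$ and $p\in[0,1]$ put $$\eta_\gamma(p)=\frac{p}{p+(1-p)\gamma},\qquad M_\gamma(p)=\eta_\gamma(p)R_\gamma^tU_\gamma R_\gamma+(1-\eta_\gamma(p))S,$$ let $m_1(\gamma,p)\le m_2(\gamma,p)\le m_3(\gamma,p)$ be the eigenvalues of $M_\gamma(p)$ (these do not depend on the choice of the angles), and let $\Gamma_\gamma=\{(m_1(\gamma,p),m_2(\gamma,p),m_3(\gamma,p)):p\in[0,1]\}$, a curve in the plane $\{m_1+m_2+m_3=1\}$ from $(s_1,s_2,s_3)$ to $U_\gamma$. The closed curve $\Gamma$ is the union, within this plane, of: $\Gamma_\alpha$ together with its reflection across the line $m_1=m_2$, and the rotations of these by multiples of $2\pi/3$; and $\Gamma_\beta$ together with its reflection across the line $m_2=m_3$,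 and the rotations of these by multiples of $2\pi/3$. (Equivalently, $\Gamma$ is the union of all images of $\Gamma_\alpha\cup\Gamma_\beta$ under permutations of the three coordinates.) $\mathcal L(S)$ is the bounded closed subset of the plane $\{m_1+m_2+m_3=1\}$ enclosed by $\Gamma$ (the curve together with the region it encloses). *)

(* Defs.v *)
From mathcomp Require Import all_boot all_order all_algebra all_fingroup.
From mathcomp Require Import all_classical all_reals all_analysis.

Set Implicit Arguments.
Unset Strict Implicit.
Unset Printing Implicit Defensive.

Import Order.TTheory GRing.Theory Num.Theory.
Import numFieldNormedType.Exports.

Local Open Scope classical_set_scope.
Local Open Scope ring_scope.

Definition vec3 (R : realType) (a b c : R) : 'rV[R]_3 :=
  \row_j [:: a; b; c]`_j.

Definition mx3 (R : realType) (rows : seq (seq R)) : 'M[R]_3 :=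
  \matrix_(i, j) (nth [::] rows i)`_j.

Definition plane (R : realType) : set 'rV[R]_3 :=
  [set m | \sum_j m ord0 j = 1].

(* The curve C together with the bounded connected components of its complement
   relative to the plane m_1 + m_2 + m_3 = 1 (not relative to R^3). *)
Definition enclosed (R : realType) (C : set 'rV[R]_3) : set 'rV[R]_3 :=
  C `|` [set m | (@plane R `\` C) m /\
                 bounded_set (connected_component (@plane R `\` C) m)].

Definition permutation_images (R : realType) (A : set 'rV[R]_3) :
    set 'rV[R]_3 :=
  \bigcup_(sigma : 'S_3) (col_perm sigma @` A).

Definition segment (R : realType) (a b : 'rV[R]_3) : set 'rV[R]_3 :=
  [set (1 - t) *: a + t *: b | t in [set t : R | 0 <= t <= 1]].

Definition quadrilateral (R : realType) (a b c d : 'rV[R]_3) : set 'rV[R]_3 :=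
  enclosed (segment a b `|` segment b c `|` segment c d `|` segment d a).

Definition L_MN (R : realType) (s1 s2 s3 : R) : set 'rV[R]_3 :=
  let va := s2 / (2 * s2 + s3) in
  let vb := s2 / (2 * s2 + s1) in
  permutation_images
    (quadrilateral (vec3 s1 s2 s3) (vec3 va va (1 - 2 * va))
                   (vec3 (1 / 3) (1 / 3) (1 / 3)) (vec3 (1 - 2 * vb) vb vb)).

Definition H (R : realType) (s1 s2 s3 x : R) : R :=
  6 * s2 * x ^+ 2 + x * (s1 * s3 - 3 * s2 - 4 * s2 ^+ 2) + 2 * s2 ^+ 2.

(* For 0 < s1 < s2 < s3 with s1 + s2 + s3 = 1, H (1/3) < 0, so that both roots
   exist and the default value 0 of xget is irrelevant. *)
Definition u_alpha (R : realType) (s1 s2 s3 : R) : R :=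
  xget 0 [set u | H s1 s2 s3 u = 0 /\
                  forall x, H s1 s2 s3 x = 0 -> u <= x].

Definition u_beta (R : realType) (s1 s2 s3 : R) : R :=
  xget 0 [set u | H s1 s2 s3 u = 0 /\
                  forall x, H s1 s2 s3 x = 0 -> x <= u].

Definition cos_2phi (R : realType) (s1 s2 s3 u : R) : R :=
  (2 * s2 * (3 * s2 - 1)
   + u * (1 + s1 ^+ 2 - 9 * s2 ^+ 2 - 2 * s1 * s3 + s3 ^+ 2))
  / (2 * (s3 - s1) * (s2 - u)).

Definition angles_alpha (R : realType) (s1 s2 s3 phi theta : R) : Prop :=
  let u := u_alpha s1 s2 s3 in
  cos (2 * phi) = cos_2phi s1 s2 s3 u /\
  cos (2 * theta) =
    (u * (s3 - s1) + (u - s2) * cos (2 * phi)) / (s2 * (1 - 3 * u)).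

Definition angles_beta (R : realType) (s1 s2 s3 phi theta : R) : Prop :=
  let u := u_beta s1 s2 s3 in
  cos (2 * phi) = cos_2phi s1 s2 s3 u /\
  cos (2 * theta) =
    (u * (s1 - s3) + (s2 - u) * cos (2 * phi)) / (s2 * (1 - 3 * u)).

Definition R_alpha (R : realType) (theta : R) : 'M[R]_3 :=
  mx3 [:: [:: 0; -1; 0];
          [:: - cos theta; 0; sin theta];
          [:: - sin theta; 0; - cos theta]].

Definition R_beta (R : realType) (theta : R) : 'M[R]_3 :=
  mx3 [:: [:: cos theta; 0; - sin theta];
          [:: sin theta; 0; cos theta];
          [:: 0; -1; 0]].

Definition eta (R : realType) (gamma p : R) : R :=
  p / (p + (1 - p) * gamma).

Definition M_mix (R : realType) (U Rot S : 'M[R]_3) (gamma p : R) : 'M[R]_3 :=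
  eta gamma p *: (Rot^T *m U *m Rot) + (1 - eta gamma p) *: S.

(* The eigenvalues are counted with multiplicity, hence the characteristic
   polynomial. *)
Definition ordered_eigenvalues (R : realType) (A : 'M[R]_3) (m : 'rV[R]_3) :
    Prop :=
  char_poly A = \prod_j ('X - (m ord0 j)%:P) /\
  (forall i j : 'I_3, (i <= j)%N -> m ord0 i <= m ord0 j).

(* The spectrum of M_mix depends on theta only through cos (2 * theta), so all
   admissible angles produce the same curve; if there were no admissible angles,
   the curve would be empty. *)
Definition Gamma_alpha (R : realType) (s1 s2 s3 : R) : set 'rV[R]_3 :=
  let u := u_alpha s1 s2 s3 in
  [set m | exists phi theta p : R,
     [/\ angles_alpha s1 s2 s3 phi theta, 0 <= p <= 1 &
         ordered_eigenvalues
           (M_mix (diag_mx (vec3 u u (1 - 2 * u))) (R_alpha theta)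
                  (diag_mx (vec3 s1 s2 s3)) (u / s2) p) m]].

Definition Gamma_beta (R : realType) (s1 s2 s3 : R) : set 'rV[R]_3 :=
  let u := u_beta s1 s2 s3 in
  [set m | exists phi theta p : R,
     [/\ angles_beta s1 s2 s3 phi theta, 0 <= p <= 1 &
         ordered_eigenvalues
           (M_mix (diag_mx (vec3 (1 - 2 * u) u u)) (R_beta theta)
                  (diag_mx (vec3 s1 s2 s3)) (u / s2) p) m]].

Definition Gamma (R : realType) (s1 s2 s3 : R) : set 'rV[R]_3 :=
  permutation_images (Gamma_alpha s1 s2 s3 `|` Gamma_beta s1 s2 s3).

Definition L_set (R : realType) (s1 s2 s3 : R) : set 'rV[R]_3 :=
  enclosed (Gamma s1 s2 s3).

(* Main.v *)
Require Import Defs.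
From mathcomp Require Import all_boot all_order all_algebra all_fingroup.
From mathcomp Require Import all_classical all_reals all_analysis.
From mathcomp Require Import ring lra.

Import Order.TTheory GRing.Theory Num.Theory.
Import numFieldNormedType.Exports.
Local Open Scope classical_set_scope.
Local Open Scope ring_scope.

(* For a triple [m] with sum 1 let [H_m] be the quadratic polynomial [H] in
   which [s] is replaced by [m].  With the prescribed angles, Gamma_alpha and
   Gamma_beta are the sets of ordered [m] with [H_m u = 0] for [u = u_alpha]
   (resp. [u = u_beta]) and [m2] between [s2] and [u].  Hence the set [D] of
   nonnegative [m] whose ordered rearrangement satisfies [H_m u_alpha >= 0],
   [H_m u_beta >= 0] and [m2 >= u_alpha] is bounded, and [D] minus Gamma is open
   and closed in the plane minus Gamma, so that every point of [D] is enclosed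
   by Gamma.
   An ordered [m] of L_MN satisfies [s1 / s2 <= m1 / m2 <= 1] and
   [1 <= m3 / m2 <= s3 / s2].  In these two ratios [H_m u / m2 ^ 2] is bilinear,
   so its sign only has to be checked at the four vertices, which are [s],
   V_alpha, V_beta and the center. *)

(** * Standing hypotheses and identities for the quadratic [H] *)

Definition admissible {R : realType} (s1 s2 s3 : R) :=
  [/\ 0 < s1, s1 < s2, s2 < s3 & s1 + s2 + s3 = 1].

(** For ordered [m] and [u > 0] the last term is nonpositive, and it vanishes on the walls [m1 = m2]
    and [m2 = m3]. For [m2 > 0] the sign of the first term depends only on how [u] compares with
    [m2] and [1 / 3]. *)
Lemma H_expand_wall {R : realType} (m1 m2 m3 u : R) : m1 + m2 + m3 = 1 ->
  H m1 m2 m3 u =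
    2 * m2 * (1 - 3 * u) * (m2 - u) + u * ((m1 - m2) * (m3 - m2)).
Proof. by move=> sum1; rewrite /H (_ : m3 = 1 - m1 - m2); [ring | lra]. Qed.

(** Replacing 1 by [(1 + x + y) * t] makes [H] homogeneous of degree two in the triple, so [t ^+ 2]
    factors out and leaves an expression affine in each ratio. *)
Lemma H_ratios {R : realType} (x y t u : R) : (1 + x + y) * t = 1 ->
  H (y * t) t (x * t) u =
    t ^+ 2 * ((6 * u ^+ 2 - 3 * u) * (1 + x + y) + u * (x * y - 4) + 2).
Proof.
move=> sum1.
have -> : H (y * t) t (x * t) u = t * (t * (u * (x * y - 4) + 2) +
  (6 * u ^+ 2 - 3 * u)) by rewrite /H; ring.
have E : 6 * u ^+ 2 - 3 * u = (6 * u ^+ 2 - 3 * u) * ((1 + x + y) * t).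
  by rewrite sum1 mulr1.
by rewrite [in LHS]E; ring.
Qed.

Lemma quadratic_roots {R : realType} (p q r c : R) : 0 < p ->
  p * c ^+ 2 + q * c + r < 0 ->
  exists a b, a < b /\ forall x, p * x ^+ 2 + q * x + r = p * (x - a) * (x - b).
Proof.
move=> p_gt0 neg.
have disc_gt0 : 0 < q ^+ 2 - 4 * p * r.
  (* Completing the square at [c], where the quadratic is negative. *)
  have -> : q ^+ 2 - 4 * p * r =
    (2 * p * c + q) ^+ 2 - 4 * p * (p * c ^+ 2 + q * c + r) by ring.
  by have := sqr_ge0 (2 * p * c + q); nra.
have := sqr_sqrtr (ltW disc_gt0); rewrite -sqrtr_gt0 in disc_gt0.
set d := Num.sqrt _ in disc_gt0 * => d2.
exists ((- q - d) / (2 * p)), ((- q + d) / (2 * p)); split.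
  by rewrite ltr_pM2r ?invr_gt0; lra.
move=> x; have p_neq0 : p != 0 by rewrite gt_eqF.
have -> : r = (q ^+ 2 - d ^+ 2) / (4 * p) by rewrite d2; field.
by field.
Qed.

(** * Location of the two roots of [H] *)

Section Roots.
Context {R : realType} {s1 s2 s3 : R} (adm : admissible s1 s2 s3).
Local Notation H := (H s1 s2 s3).
Local Notation a := (u_alpha s1 s2 s3).
Local Notation b := (u_beta s1 s2 s3).
Local Notation va := (s2 / (2 * s2 + s3)).
Local Notation vb := (s2 / (2 * s2 + s1)).

Lemma H_third_lt0 : H (1 / 3) < 0.
Proof.
case: adm => s1_gt0 lt12 lt23 sum1.
have -> : H (1 / 3) = (s2 - s1) * (s2 - s3) / 3.
  by rewrite /Defs.H (_ : s3 = 1 - s1 - s2); [field | lra].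
nra.
Qed.

Lemma H_factor : a < b /\ forall x, H x = 6 * s2 * (x - a) * (x - b).
Proof.
case: adm => s1_gt0 lt12 lt23 sum1.
have HE x : H x =
    6 * s2 * x ^+ 2 + (s1 * s3 - 3 * s2 - 4 * s2 ^+ 2) * x + 2 * s2 ^+ 2.
  by rewrite /Defs.H; ring.
have s2_gt0 : 0 < 6 * s2 by lra.
have := H_third_lt0; rewrite HE => /(quadratic_roots _ _ _ _ s2_gt0).
move=> [r1 [r2 [lt_r HF]]].
have H0 x : H x = 0 <-> x = r1 \/ x = r2.
  rewrite HE HF; split=> [/eqP|]; last by case=> ->; ring.
  rewrite -mulrA mulf_eq0 (gt_eqF s2_gt0) mulf_eq0 !subr_eq0 /=.
  by case/orP=> /eqP ->; [left | right].
have -> : a = r1.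
  apply: xget_unique => [|y [/H0 y_root /(_ r1) min_y]].
    by split=> [|x /H0[] ->]; [apply/H0; left | | exact: ltW].
  have : y <= r1 by apply: min_y; apply/H0; left.
  by case: y_root => -> //; rewrite leNgt lt_r.
have -> : b = r2.
  apply: xget_unique => [|y [/H0 y_root /(_ r2) max_y]].
    by split=> [|x /H0[] ->]; [apply/H0; right | exact: ltW |].
  have : r2 <= y by apply: max_y; apply/H0; right.
  by case: y_root => -> //; rewrite leNgt lt_r.
by split=> // x; rewrite HE.
Qed.

(** Vieta's formula, read off from the value of [H] at 0. It later compares [m2] with [s2] on the
    curves. *)
Lemma roots_mul : 3 * (a * b) = s2.
Proof.
case: adm => s1_gt0 lt12 lt23 sum1.
have [_ /(_ 0)] := H_factor; rewrite /Defs.H => e.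
by apply: (@mulfI _ (2 * s2)); [rewrite gt_eqF //; lra | lra].
Qed.

Lemma H_lt0_between x : H x < 0 -> a < x < b.
Proof.
case: adm => s1_gt0 lt12 lt23 sum1.
have [ltab HF] := H_factor; rewrite HF -mulrA pmulr_rlt0; last lra.
move=> neg; case: (ltP a x) => ax; last by nra.
by case: (ltP x b) => //= bx; nra.
Qed.

Lemma third_between : a < 1 / 3 < b.
Proof. exact/H_lt0_between/H_third_lt0. Qed.

Lemma s2_between : a < s2 < b.
Proof.
case: adm => s1_gt0 lt12 lt23 sum1; apply: H_lt0_between.
have -> : H s2 = s2 * ((s2 - s1) * (s2 - s3)).
  by rewrite /Defs.H (_ : s3 = 1 - s1 - s2); [ring | lra].
by rewrite pmulr_rlt0 ?nmulr_llt0; lra.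
Qed.

Lemma va_between : a < va < b.
Proof.
case: adm => s1_gt0 lt12 lt23 sum1; apply: H_lt0_between.
have den : 0 < 2 * s2 + s3 by lra.
rewrite H_expand_wall //.
have -> : 2 * s2 * (1 - 3 * va) * (s2 - va) + va * ((s1 - s2) * (s3 - s2)) =
  s2 * (s3 - s2) / (2 * s2 + s3) ^+ 2 *
  (2 * s2 * (2 * s2 + s3 - 1) + (s1 - s2) * (2 * s2 + s3)).
  by field; rewrite gt_eqF.
rewrite pmulr_rlt0; last by rewrite divr_gt0 ?exprn_gt0 ?mulr_gt0; lra.
(* Once 1 is replaced by the sum, the remaining factor is [- (s2 - s1) * s3]. *)
by rewrite (_ : 1 = s1 + s2 + s3) //; nra.
Qed.

Lemma vb_between : a < vb < b.
Proof.
case: adm => s1_gt0 lt12 lt23 sum1; apply: H_lt0_between.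
have den : 0 < 2 * s2 + s1 by lra.
rewrite H_expand_wall //.
have -> : 2 * s2 * (1 - 3 * vb) * (s2 - vb) + vb * ((s1 - s2) * (s3 - s2)) =
  - (s2 * (s2 - s1) / (2 * s2 + s1) ^+ 2 *
  (2 * s2 * (2 * s2 + s1 - 1) + (s3 - s2) * (2 * s2 + s1))).
  by field; rewrite gt_eqF.
rewrite oppr_lt0 mulr_gt0 //.
  by rewrite divr_gt0 ?exprn_gt0 ?mulr_gt0; lra.
by rewrite (_ : 1 = s1 + s2 + s3) //; nra.
Qed.

Lemma alpha_gt0 : 0 < a.
Proof.
case: adm => s1_gt0 lt12 lt23 sum1.
have := roots_mul; have /andP[_ ?] := third_between; nra.
Qed.

(** [H] is positive at [1 / 2], which lies to the right of the smaller root, hence also of the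
    greater one. *)
Lemma beta_lt_half : b < 1 / 2.
Proof.
case: adm => s1_gt0 lt12 lt23 sum1.
have [_ /(_ (1 / 2))] := H_factor; have /andP[? _] := third_between.
have -> : H (1 / 2) = s1 * s3 / 2 by rewrite /Defs.H; field.
move=> e; have : 0 < 6 * s2 * (1 / 2 - a) * (1 / 2 - b).
  by rewrite -e divr_gt0 ?mulr_gt0; lra.
by rewrite pmulr_rgt0; [lra | rewrite mulr_gt0; lra].
Qed.
End Roots.

(** * Angles and spectra along the two curves *)

Lemma char_poly_cross {R : realType} (x t w z m1 m3 : R) :
  x + w = m1 + m3 -> x * w - z ^+ 2 = m1 * m3 ->
  char_poly (mx3 [:: [:: x; 0; z]; [:: 0; t; 0]; [:: z; 0; w]]) =
  \prod_j ('X - (vec3 m1 t m3 ord0 j)%:P).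
Proof.
move=> tr det.
rewrite /char_poly; do 3 rewrite !(expand_det_row _ ord0) /cofactor
   !big_ord_recl !big_ord0.
rewrite !det_mx00 !mxE /=.
rewrite /bump /= !mulr1n !mulr0n.
(* The middle basis vector splits off; the other factor is the characteristic polynomial of the
   outer 2 by 2 block, given by its trace and determinant. *)
transitivity (('X - t%:P) * ('X ^+ 2 - (x + w)%:P * 'X + (x * w - z ^+ 2)%:P)).
  by rewrite !raddfB !raddfD /= !(rmorphM, rmorphXn) /=; ring.
by rewrite tr det raddfD /= rmorphM /=; ring.
Qed.

(** The value prescribed for [cos (2 * theta)] on the alpha curve, with [phi] eliminated and [u]
    general. The beta curve prescribes its opposite. *)
Definition cos_2theta {R : realType} (s1 s2 s3 u : R) :=
  (u * (s3 - s1) + (u - s2) * cos_2phi s1 s2 s3 u) / (s2 * (1 - 3 * u)).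

(** The common feature of both roots: differences between [u] and the four reference values all have
    one sign. This allows a single treatment of alpha and beta. *)
Definition same_side {R : realType} (s1 s2 s3 u : R) :=
  [&& u < s2 / (2 * s2 + s3), u < s2 / (2 * s2 + s1), u < s2 & u < 1 / 3] ||
  [&& s2 / (2 * s2 + s3) < u, s2 / (2 * s2 + s1) < u, s2 < u & 1 / 3 < u].

Section Curves.
Context {R : realType} {s1 s2 s3 : R} (adm : admissible s1 s2 s3).
Local Notation va := (s2 / (2 * s2 + s3)).
Local Notation vb := (s2 / (2 * s2 + s1)).

Lemma same_side_alpha : same_side s1 s2 s3 (u_alpha s1 s2 s3).
Proof.
move: (third_between adm) (s2_between adm) (va_between adm) (vb_between adm).
by rewrite /same_side => /andP[-> _] /andP[-> _] /andP[-> _] /andP[-> _].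
Qed.

Lemma same_side_beta : same_side s1 s2 s3 (u_beta s1 s2 s3).
Proof.
move: (third_between adm) (s2_between adm) (va_between adm) (vb_between adm).
by rewrite /same_side => /andP[_ ->] /andP[_ ->] /andP[_ ->] /andP[_ ->];
  rewrite orbT.
Qed.

Lemma same_side_neq0 u : same_side s1 s2 s3 u -> s2 - u != 0 /\ 1 - 3 * u != 0.
Proof.
move=> side; split.
  by rewrite subr_eq0; case/orP: side => /and4P[_ _]; [case: ltgtP ..].
by case/orP: side => /and4P[_ _ _ ?]; [rewrite gt_eqF | rewrite lt_eqF]; lra.
Qed.

(** Makes the angle exist: [1 + cos_2phi] and [1 - cos_2phi] are each a positive constant times a
    quotient of two differences that share their sign by [same_side]. *)
Lemma cos_2phi_itv u : same_side s1 s2 s3 u -> cos_2phi s1 s2 s3 u \in `[-1, 1].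
Proof.
case: adm => s1_gt0 lt12 lt23 sum1 side.
have [nz _] := same_side_neq0 _ side.
rewrite in_itv /=; apply/andP; split; rewrite -subr_ge0.
  have -> : cos_2phi s1 s2 s3 u - -1 =
    2 * (s2 - s1) * (2 * s2 + s1) / (s3 - s1) * ((vb - u) / (s2 - u)).
    rewrite /cos_2phi (_ : s3 = 1 - s1 - s2); last lra.
    field; rewrite nz /=; apply/andP; split; lra.
  apply: mulr_ge0; first by rewrite divr_ge0 ?mulr_ge0; lra.
  case/orP: side => /and4P[]; move: (va) (vb) => v w *.
    by rewrite divr_ge0; lra.
  by rewrite -mulrNN -invrN divr_ge0; lra.
have -> : 1 - cos_2phi s1 s2 s3 u =
  2 * (s3 - s2) * (2 * s2 + s3) / (s3 - s1) * ((va - u) / (s2 - u)).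
  rewrite /cos_2phi (_ : s1 = 1 - s3 - s2); last lra.
  field; rewrite nz /=; apply/andP; split; lra.
apply: mulr_ge0; first by rewrite divr_ge0 ?mulr_ge0; lra.
case/orP: side => /and4P[]; move: (va) (vb) => v w *.
  by rewrite divr_ge0; lra.
by rewrite -mulrNN -invrN divr_ge0; lra.
Qed.


Lemma cos_2theta_itv u : same_side s1 s2 s3 u ->
  cos_2theta s1 s2 s3 u \in `[-1, 1].
Proof.
case: adm => s1_gt0 lt12 lt23 sum1 side.
have [nz nz3] := same_side_neq0 _ side.
rewrite in_itv /=; apply/andP; split; rewrite -subr_ge0.
  have -> : cos_2theta s1 s2 s3 u - -1 =
    2 * (s3 - s2) * (2 * s2 + s1) / (s2 * (s3 - s1)) * ((vb - u) / (1 - 3 * u)).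
    rewrite /cos_2theta /cos_2phi (_ : s1 = 1 - s3 - s2); last lra.
    field; rewrite nz nz3 /=; repeat (apply/andP; split); lra.
  apply: mulr_ge0; first by rewrite divr_ge0 ?mulr_ge0; lra.
  case/orP: side => /and4P[]; move: (va) (vb) => v w *.
    by rewrite divr_ge0; lra.
  by rewrite -mulrNN -invrN divr_ge0; lra.
have -> : 1 - cos_2theta s1 s2 s3 u =
  2 * (s2 - s1) * (2 * s2 + s3) / (s2 * (s3 - s1)) * ((va - u) / (1 - 3 * u)).
  rewrite /cos_2theta /cos_2phi (_ : s3 = 1 - s1 - s2); last lra.
  field; rewrite nz nz3 /=; repeat (apply/andP; split); lra.
apply: mulr_ge0; first by rewrite divr_ge0 ?mulr_ge0; lra.
case/orP: side => /and4P[]; move: (va) (vb) => v w *.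
  by rewrite divr_ge0; lra.
by rewrite -mulrNN -invrN divr_ge0; lra.
Qed.

(* Thanks to this choice of the angle, the ratio [m1 * m3 / m2] is an affine
   function of the middle eigenvalue [m2] along the curve. *)
Lemma cos_2theta_mix u : same_side s1 s2 s3 u ->
  (1 - 3 * u) * ((1 - cos_2theta s1 s2 s3 u) / 2 * s3
                 + (1 + cos_2theta s1 s2 s3 u) / 2 * s1) =
  s2 + u * (s1 * s3 / s2 - s2 - 1).
Proof.
case: adm => s1_gt0 lt12 lt23 sum1 side.
have [nz nz3] := same_side_neq0 _ side.
rewrite /cos_2theta /cos_2phi (_ : s3 = 1 - s1 - s2); last lra.
field; rewrite nz nz3 /=; repeat (apply/andP; split); lra.
Qed.

(** Here [x], [w], [z] are the entries of the outer block of the mixture with weight [e], and [k],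
    [l] stand for the sine and cosine of the angle (exchanged, up to sign, for beta). *)
Lemma mix_spectrum u k l e m1 t m3 :
  same_side s1 s2 s3 u -> u != 0 -> H s1 s2 s3 u = 0 -> H m1 t m3 u = 0 ->
  k ^+ 2 = (1 - cos_2theta s1 s2 s3 u) / 2 ->
  l ^+ 2 = (1 + cos_2theta s1 s2 s3 u) / 2 ->
  t = (1 - e) * s2 + e * u -> m1 + t + m3 = 1 ->
  let x := e * (u * l ^+ 2 + (1 - 2 * u) * k ^+ 2) + (1 - e) * s1 in
  let w := e * (u * k ^+ 2 + (1 - 2 * u) * l ^+ 2) + (1 - e) * s3 in
  let z := e * ((1 - 3 * u) * k * l) in
  x + w = m1 + m3 /\ x * w - z ^+ 2 = m1 * m3.
Proof.
move=> side u_neq0 Hs Hm k2 l2 tE sum_m x w z.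
have [s1_gt0 lt12 lt23 sum_s] := adm.
have s2_neq0 : s2 != 0 by lra.
have kl : l ^+ 2 = 1 - k ^+ 2 by rewrite k2 l2; field.
have mix := cos_2theta_mix _ side; rewrite -k2 -l2 in mix.
split.
  rewrite /x /w kl (_ : m1 + m3 = 1 - t); last lra.
  by rewrite tE (_ : s3 = 1 - s1 - s2); [ring | lra].
(* Vanishing of [H] at [u] makes the product of the outer entries one fixed function of the middle
   entry, for [s] and [m] alike. *)
have s13 : s1 * s3 = s2 * (3 - 6 * u + (4 - 2 / u) * s2).
  apply: (mulfI u_neq0); apply/eqP; rewrite -subr_eq0 -[X in _ == X]Hs /H.
  by apply/eqP; field.
have m13 : m1 * m3 = t * (3 - 6 * u + (4 - 2 / u) * t).
  apply: (mulfI u_neq0); apply/eqP; rewrite -subr_eq0 -[X in _ == X]Hm /H.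
  by apply/eqP; field.
(* Only the coefficient of [e * (1 - e)] involves the angle, and [mix] eliminates it there. *)
have -> : x * w - z ^+ 2 =
  e ^+ 2 * u * (1 - 2 * u) + (1 - e) ^+ 2 * (s1 * s3)
  + e * (1 - e) * (u * (1 - s2) +
                   (1 - 3 * u) * (k ^+ 2 * s3 + l ^+ 2 * s1)).
  rewrite /x /w /z !exprMn kl (_ : 1 - s2 = s1 + s3); last lra.
  by ring.
by rewrite mix s13 m13 tE; field; rewrite u_neq0.
Qed.

Lemma eta_onto u t : 0 < u -> u != s2 ->
  (u <= t <= s2) || (s2 <= t <= u) ->
  exists2 p, 0 <= p <= 1 & t = (1 - eta (u / s2) p) * s2 + eta (u / s2) p * u.
Proof.
case: adm => s1_gt0 lt12 lt23 sum1 u_gt0 us2 tin.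
have t_gt0 : 0 < t by case/orP: tin => /andP[? ?]; lra.
have nz : s2 - u != 0 by rewrite subr_eq0 eq_sym.
have s2_neq0 : s2 != 0 by lra.
(* This [p] solves [eta (u / s2) p = (s2 - t) / (s2 - u)], the weight that moves the middle
   eigenvalue from [s2] to [t]. *)
exists (u / t * ((s2 - t) / (s2 - u))).
  have pC : 1 - u / t * ((s2 - t) / (s2 - u)) = s2 / t * ((t - u) / (s2 - u)).
    by field; rewrite nz gt_eqF.
  have [? ?] : 0 <= (s2 - t) / (s2 - u) /\ 0 <= (t - u) / (s2 - u).
    case/orP: tin => /andP[? ?]; first by rewrite !divr_ge0; lra.
    by rewrite -mulrNN -invrN -[(t - u) / _]mulrNN -invrN !divr_ge0; lra.
  by apply/andP; split; rewrite -subr_ge0 ?subr0 ?pC mulr_ge0 // divr_ge0; lra.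
rewrite /eta.
set p := u / t * _.
have -> : p + (1 - p) * (u / s2) = u / t.
  by rewrite /p; field; rewrite nz s2_neq0 gt_eqF.
by rewrite /p; field; rewrite nz !gt_eqF.
Qed.

Lemma cos_surj (y : R) : y \in `[-1, 1] -> exists x, cos (2 * x) = y.
Proof.
move=> /acosK yK; exists (acos y / 2).
by rewrite mulrC divfK // yK.
Qed.

Lemma cos2_double (x : R) : cos x ^+ 2 = (1 + cos (2 * x)) / 2.
Proof. by rewrite mulr_natl cos_mulr2n; field. Qed.

Lemma sin2_double (x : R) : sin x ^+ 2 = (1 - cos (2 * x)) / 2.
Proof. by rewrite sin2cos2 cos2_double; field. Qed.

Lemma sorted_vec3 (m1 m2 m3 : R) : m1 <= m2 -> m2 <= m3 ->
  forall i j : 'I_3, (i <= j)%N -> vec3 m1 m2 m3 ord0 i <= vec3 m1 m2 m3 ord0 j.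
Proof.
move=> le12 le23 [[|[|[|i]]] ilt] [[|[|[|j]]] jlt] //= _; rewrite !mxE //=.
exact: le_trans le23.
Qed.

(** The middle entry determines the weight, hence [p]; the total and [H = 0] then fix the sum and
    product of the outer entries, which are those of the mixture. *)
Lemma mem_Gamma_alpha m1 m2 m3 : m1 <= m2 -> m2 <= m3 -> m1 + m2 + m3 = 1 ->
  u_alpha s1 s2 s3 <= m2 <= s2 -> H m1 m2 m3 (u_alpha s1 s2 s3) = 0 ->
  Gamma_alpha s1 s2 s3 (vec3 m1 m2 m3).
Proof.
move=> le12 le23 sum1 m2_in Hm.
have side := same_side_alpha.
have u_gt0 := alpha_gt0 adm.
have [_ /(_ (u_alpha s1 s2 s3))] := H_factor adm.
have /andP[us2 _] := s2_between adm.
rewrite subrr mulr0 mul0r => Hs.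
have [phi phiE] := cos_surj _ (cos_2phi_itv _ side).
have [theta thetaE] := cos_surj _ (cos_2theta_itv _ side).
have [||p p01 m2E] := eta_onto _ m2 u_gt0 _ _; rewrite ?m2_in //.
  by rewrite lt_eqF.
exists phi, theta, p; split=> //.
  by split=> //; rewrite thetaE /cos_2theta phiE.
split; last exact: sorted_vec3.
have [||tr det] := mix_spectrum _ (sin theta) (cos theta) _ _ _ _ side
  (lt0r_neq0 u_gt0) Hs Hm _ _ m2E sum1.
- by rewrite sin2_double thetaE.
- by rewrite cos2_double thetaE.
rewrite -(char_poly_cross _ m2 _ _ _ _ tr det); congr char_poly.
apply/matrixP => i j; rewrite /M_mix !(mxE, big_ord_recl, big_ord0).
move: i j => [[|[|[|i]]] ilt] [[|[|[|j]]] jlt] //=; rewrite ?[in RHS]m2E; ring.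
Qed.

Lemma mem_Gamma_beta m1 m2 m3 : m1 <= m2 -> m2 <= m3 -> m1 + m2 + m3 = 1 ->
  s2 <= m2 <= u_beta s1 s2 s3 -> H m1 m2 m3 (u_beta s1 s2 s3) = 0 ->
  Gamma_beta s1 s2 s3 (vec3 m1 m2 m3).
Proof.
move=> le12 le23 sum1 m2_in Hm.
have side := same_side_beta.
have [_ /(_ (u_beta s1 s2 s3))] := H_factor adm.
have /andP[_ us2] := s2_between adm.
have u_gt0 : 0 < u_beta s1 s2 s3.
  by case: adm => *; lra.
rewrite subrr mulr0 => Hs.
have [phi phiE] := cos_surj _ (cos_2phi_itv _ side).
have [theta thetaE] : exists x, cos (2 * x) =
    - cos_2theta s1 s2 s3 (u_beta s1 s2 s3).
  apply: cos_surj; have := cos_2theta_itv _ side; rewrite !in_itv /=; lra.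
have [||p p01 m2E] := eta_onto _ m2 u_gt0 _ _; rewrite ?m2_in ?orbT //.
  by rewrite gt_eqF.
exists phi, theta, p; split=> //.
  by split=> //; rewrite thetaE /cos_2theta phiE -mulNr; congr (_ / _); ring.
split; last exact: sorted_vec3.
(* The opposite sign of [cos (2 * theta)] exchanges sine and cosine; the minus sign matches the
   off-diagonal entry produced by [R_beta]. *)
have [||tr det] := mix_spectrum _ (cos theta) (- sin theta) _ _ _ _ side
  (lt0r_neq0 u_gt0) Hs Hm _ _ m2E sum1.
- by rewrite cos2_double thetaE.
- by rewrite sqrrN sin2_double thetaE opprK.
rewrite -(char_poly_cross _ m2 _ _ _ _ tr det); congr char_poly.
apply/matrixP => i j; rewrite /M_mix !(mxE, big_ord_recl, big_ord0).
move: i j => [[|[|[|i]]] ilt] [[|[|[|j]]] jlt] //=; rewrite ?[in RHS]m2E; ring.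
Qed.

End Curves.

(** * Signs of [H] in the ordered chamber *)

Definition chamber_cell {R : realType} (s1 s2 s3 m1 m2 m3 : R) :=
  [/\ m1 <= m2, m2 <= m3, m1 + m2 + m3 = 1, m3 * s2 <= m2 * s3
    & m2 * s1 <= m1 * s2].

Section Chamber.
Context {R : realType} {s1 s2 s3 : R} (adm : admissible s1 s2 s3).
Local Notation a := (u_alpha s1 s2 s3).
Local Notation b := (u_beta s1 s2 s3).
Local Notation va := (s2 / (2 * s2 + s3)).
Local Notation vb := (s2 / (2 * s2 + s1)).

Lemma cell_gt0 (m1 m2 m3 : R) : chamber_cell s1 s2 s3 m1 m2 m3 ->
  0 < m1 /\ 0 < m2.
Proof.
case: adm => s1_gt0 lt12 lt23 sum_s [le12 le23 sum_m le3 le1].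
have m2_gt0 : 0 < m2 by nra.
by split=> //; nra.
Qed.

Lemma H_cell_ge0 (u m1 m2 m3 : R) : 0 < u -> same_side s1 s2 s3 u ->
  H s1 s2 s3 u = 0 -> chamber_cell s1 s2 s3 m1 m2 m3 -> 0 <= H m1 m2 m3 u.
Proof.
move=> u_gt0 side Hs cell; have [m1_gt0 m2_gt0] := cell_gt0 _ _ _ cell.
case: adm => s1_gt0 lt12 lt23 sum_s; case: cell => le12 le23 sum_m le3 le1.
have s2_gt0 : 0 < s2 by lra.
pose h (x y : R) : R :=
  (6 * u ^+ 2 - 3 * u) * (1 + x + y) + u * (x * y - 4) + 2.
pose x := m3 / m2; pose y := m1 / m2; pose X := s3 / s2; pose Y := s1 / s2.
have hE : H m1 m2 m3 u = m2 ^+ 2 * h x y.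
  rewrite -H_ratios /x /y ?divfK ?gt_eqF //.
  by rewrite !mulrDl !divfK ?gt_eqF //; lra.
have hS : h X Y = 0.
  have /eqP : s2 ^+ 2 * h X Y = 0.
    rewrite -H_ratios /X /Y ?divfK ?gt_eqF ?Hs //.
    by rewrite !mulrDl !divfK ?gt_eqF //; lra.
  by rewrite mulf_eq0 sqrf_eq0 gt_eqF //= => /eqP.
have [x1 xX] : 1 <= x /\ x <= X.
  by rewrite /x /X ler_pdivlMr // ler_pdivrMr // mulrAC ler_pdivlMr //; lra.
have [y1 yY] : y <= 1 /\ Y <= y.
  by rewrite /y /Y ler_pdivrMr // ler_pdivlMr // mulrAC ler_pdivrMr //; lra.
have X1 : 1 < X by rewrite ltr_pdivlMr //; lra.
have Y1 : Y < 1 by rewrite ltr_pdivrMr //; lra.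
have Y0 : 0 < Y by rewrite divr_gt0.
(* The corner [(1, 1)] of the rectangle of ratios is the center [(1/3, 1/3, 1/3)]. *)
have h11 : 0 <= h 1 1.
  have -> : h 1 1 = 2 * (3 * u - 1) ^+ 2 by rewrite /h; ring.
  by rewrite mulr_ge0 ?sqr_ge0.
(* On the two walls through the center, [h] as a quadratic in [u] has the roots [1 / 3] and
   [1 / (2 + z)]; the latter is [va] for [z = X] and [vb] for [z = Y]. *)
have hz1 z : 0 < z -> 0 <= (1 - 3 * u) * (1 / (2 + z) - u) ->
    0 <= (6 * u ^+ 2 - 3 * u) * (2 + z) + u * (z - 4) + 2.
  move=> z0 pos.
  have -> : (6 * u ^+ 2 - 3 * u) * (2 + z) + u * (z - 4) + 2 =
    2 * (2 + z) * ((1 - 3 * u) * (1 / (2 + z) - u)).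
    by field; rewrite gt_eqF //; lra.
  by rewrite mulr_ge0 //; lra.
have vaE : va = 1 / (2 + X) by rewrite /X; field; rewrite !gt_eqF //; lra.
have vbE : vb = 1 / (2 + Y) by rewrite /Y; field; rewrite !gt_eqF //; lra.
have hX1 : 0 <= h X 1.
  have -> : h X 1 = (6 * u ^+ 2 - 3 * u) * (2 + X) + u * (X - 4) + 2.
    by rewrite /h; ring.
  apply: hz1; first lra.
  rewrite -vaE; case/orP: side => /and4P[]; move: (va) (vb) => v w *; nra.
have h1Y : 0 <= h 1 Y.
  have -> : h 1 Y = (6 * u ^+ 2 - 3 * u) * (2 + Y) + u * (Y - 4) + 2.
    by rewrite /h; ring.
  apply: hz1; first lra.
  rewrite -vbE; case/orP: side => /and4P[]; move: (va) (vb) => v w *; nra.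
rewrite hE mulr_ge0 ?sqr_ge0 // -(@pmulr_rge0 _ ((X - 1) * (1 - Y))).
  (* Bilinear interpolation from the four corners; the corner [(X, Y)] is [s], where [h]
     vanishes. *)
  have -> : (X - 1) * (1 - Y) * h x y =
    (X - x) * (1 - y) * h 1 Y + (X - x) * (y - Y) * h 1 1
    + (x - 1) * (1 - y) * h X Y + (x - 1) * (y - Y) * h X 1.
    by rewrite /h; ring.
  by rewrite hS mulr0 addr0 !addr_ge0 ?mulr_ge0 //; lra.
by rewrite mulr_gt0; lra.
Qed.

(** If [m2 < a], the first term of [H_expand_wall] is negative and the second nonpositive. *)
Lemma mid_ge_alpha (m1 m2 m3 : R) : 0 < m2 -> m1 <= m2 -> m2 <= m3 ->
  m1 + m2 + m3 = 1 -> 0 <= H m1 m2 m3 a -> a <= m2.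
Proof.
move=> m2_gt0 le12 le23 sum_m; rewrite H_expand_wall //.
have a_gt0 := alpha_gt0 adm; have /andP[a3 _] := third_between adm.
case: (leP a m2) => // m2a pos; suff : 0 < 0 :> R by rewrite ltxx.
have p1 : 0 < m2 * (1 - 3 * a) * (a - m2) by rewrite !mulr_gt0; lra.
have p2 : 0 <= a * ((m2 - m1) * (m3 - m2)) by rewrite !mulr_ge0; lra.
lra.
Qed.

Lemma mid_gt_alpha (m1 m2 m3 : R) : 0 < m2 -> m1 <= m2 -> m2 <= m3 ->
  m1 + m2 + m3 = 1 -> 0 < H m1 m2 m3 a -> a < m2.
Proof.
move=> m2_gt0 le12 le23 sum_m Hm; rewrite lt_neqAle.
rewrite (mid_ge_alpha _ _ _ m2_gt0 le12 le23 sum_m (ltW Hm)) andbT.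
apply: contraTneq Hm => m2E; rewrite H_expand_wall // -leNgt.
rewrite m2E subrr mulr0 add0r -m2E -oppr_ge0 -mulrN mulr_ge0 //.
  exact/ltW/alpha_gt0.
by rewrite -mulNr mulr_ge0; lra.
Qed.

Lemma mid_le_beta (m1 m2 m3 : R) : 0 < m2 -> m1 <= m2 -> m2 <= m3 ->
  m1 + m2 + m3 = 1 -> 0 <= H m1 m2 m3 b -> m2 <= b.
Proof.
move=> m2_gt0 le12 le23 sum_m; rewrite H_expand_wall //.
have /andP[_ b3] := third_between adm.
case: (leP m2 b) => // m2b pos; suff : 0 < 0 :> R by rewrite ltxx.
have p1 : 0 < m2 * (3 * b - 1) * (m2 - b) by rewrite !mulr_gt0; lra.
have p2 : 0 <= b * ((m2 - m1) * (m3 - m2)) by rewrite !mulr_ge0; lra.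
lra.
Qed.

(* The roots of [H m1 m2 m3] have product [m2 / 3]. *)
Lemma H_other_root (m1 m2 m3 u v : R) : u != 0 -> H m1 m2 m3 u = 0 ->
  u * H m1 m2 m3 v = 2 * m2 * (v - u) * (3 * (u * v) - m2).
Proof.
move=> u_neq0 Hu; rewrite -[LHS]subr0 -(mulr0 v) -Hu /H; ring.
Qed.

(** The wall estimates give one bound on [m2]. For the other, [H_other_root] and [3 * (a * b) = s2]
    turn the sign of [H] at the second root into a comparison of [m2] with [s2]. *)
Lemma mem_Gamma (m1 m2 m3 : R) : 0 < m2 -> m1 <= m2 -> m2 <= m3 ->
  m1 + m2 + m3 = 1 -> 0 <= H m1 m2 m3 a -> 0 <= H m1 m2 m3 b ->
  H m1 m2 m3 a = 0 \/ H m1 m2 m3 b = 0 ->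
  (Gamma_alpha s1 s2 s3 `|` Gamma_beta s1 s2 s3) (vec3 m1 m2 m3).
Proof.
move=> m2_gt0 le12 le23 sum_m Ha Hb; have a_gt0 := alpha_gt0 adm.
have [ltab _] := H_factor adm; have ab := roots_mul adm.
have b_gt0 : 0 < b by exact: lt_trans ltab.
case=> H0; [left; apply: mem_Gamma_alpha | right; apply: mem_Gamma_beta] => //.
  rewrite (mid_ge_alpha _ _ _ m2_gt0 le12 le23 sum_m Ha) /=.
  have : 0 <= a * H m1 m2 m3 b by rewrite mulr_ge0 // ltW.
  rewrite H_other_root ?gt_eqF // pmulr_rge0 ?mulr_gt0 ?subr_gt0 //; lra.
rewrite (mid_le_beta _ _ _ m2_gt0 le12 le23 sum_m Hb) andbT.
have : 0 <= b * H m1 m2 m3 a by rewrite mulr_ge0 // ltW.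
rewrite H_other_root ?gt_eqF // [b * a]mulrC ab.
by rewrite nmulr_rge0 ?pmulr_rlt0 ?mulr_gt0 // ; lra.
Qed.

(** At [m1 = 0] the value of [H] at [b] factors, and it is negative because [2 * m2 <= 1 < 3 * b]
    and [b < 1 / 2]. *)
Lemma min_gt0 (m1 m2 m3 : R) : 0 <= m1 -> a <= m2 -> m2 <= m3 ->
  m1 + m2 + m3 = 1 -> 0 <= H m1 m2 m3 b -> 0 < m1.
Proof.
move=> m1_ge0 am2 le23 sum_m Hb; rewrite lt_neqAle m1_ge0 andbT.
apply: contraTneq Hb => m1E; rewrite -ltNge -m1E.
have -> : H 0 m2 m3 b = m2 * ((1 - 2 * b) * (2 * m2 - 3 * b)).
  by rewrite /H; ring.
have a_gt0 := alpha_gt0 adm; have /andP[_ b3] := third_between adm.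
have b2 := beta_lt_half adm.
by rewrite pmulr_rlt0 ?pmulr_rlt0; lra.
Qed.

End Chamber.

(** * Extreme entries of a row vector, and sorting *)

Definition row_min {R : realType} {n} (m : 'rV[R]_n.+1) : R :=
  \big[Num.min/m ord0 ord0]_j m ord0 j.

Definition row_max {R : realType} {n} (m : 'rV[R]_n.+1) : R :=
  \big[Num.max/m ord0 ord0]_j m ord0 j.

(** The seed of the fold is itself a coordinate, so induction on the index list starts from a
    continuous function. *)
Lemma row_min_continuous {R : realType} {n} :
  continuous (@row_min R n : 'rV[R]_n.+1 -> R).
Proof.
rewrite /row_min; elim: (index_enum _) => [|j r IH].
  rewrite (_ : (fun _ => _) = (fun m : 'rV[R]_n.+1 => m ord0 ord0)).
    exact: coord_continuous.
  by apply/funext => m; rewrite big_nil.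
rewrite (_ : (fun _ => _) = (fun m : 'rV[R]_n.+1 => m ord0 j) \min
  (fun m => \big[Num.min/m ord0 ord0]_(j <- r) m ord0 j)).
  by move=> m; apply: continuous_min; [exact: coord_continuous | exact: IH].
by apply/funext => m; rewrite big_cons.
Qed.

Lemma row_max_continuous {R : realType} {n} :
  continuous (@row_max R n : 'rV[R]_n.+1 -> R).
Proof.
rewrite /row_max; elim: (index_enum _) => [|j r IH].
  rewrite (_ : (fun _ => _) = (fun m : 'rV[R]_n.+1 => m ord0 ord0)).
    exact: coord_continuous.
  by apply/funext => m; rewrite big_nil.
rewrite (_ : (fun _ => _) = (fun m : 'rV[R]_n.+1 => m ord0 j) \max
  (fun m => \big[Num.max/m ord0 ord0]_(j <- r) m ord0 j)).
  by move=> m; apply: continuous_max; [exact: coord_continuous | exact: IH].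
by apply/funext => m; rewrite big_cons.
Qed.

Definition row_sorted {R : realType} {n} (v : 'rV[R]_n) :=
  forall i j : 'I_n, (i <= j)%N -> v ord0 i <= v ord0 j.

Lemma row_min_perm {R : realType} {n} (v : 'rV[R]_n.+1) (s : 'S_n.+1) :
  row_sorted v -> row_min (col_perm s v) = v ord0 ord0.
Proof.
move=> v_sorted; apply/le_anti/andP; split.
  apply: le_trans (bigmin_le _ ((s^-1)%g ord0) _) _.
  by rewrite mxE permKV.
by apply/bigmin_geP; split=> [|i _]; rewrite mxE v_sorted.
Qed.

Lemma row_max_perm {R : realType} {n} (v : 'rV[R]_n.+1) (s : 'S_n.+1) :
  row_sorted v -> row_max (col_perm s v) = v ord0 ord_max.
Proof.
move=> v_sorted; apply/le_anti/andP; split.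
  by apply/bigmax_leP; split=> [|i _]; rewrite mxE v_sorted // leq_ord.
apply: le_trans (le_bigmax _ _ ((s^-1)%g ord_max)).
by rewrite mxE permKV.
Qed.

Lemma sort_row {R : realType} {n} (m : 'rV[R]_n) :
  exists (s : 'S_n) (v : 'rV[R]_n), row_sorted v /\ m = col_perm s v.
Proof.
pose t := [tuple m ord0 i | i < n].
have /tuple_permP[s sE] : perm_eq (sort <=%R t) t by rewrite perm_sort.
exists (s^-1)%g, (col_perm s m); split; last first.
  by rewrite -col_permM mulVg col_perm1.
have entry (i : 'I_n) : col_perm s m ord0 i = nth 0 (sort <=%R t) i.
  by rewrite sE mxE (nth_map i) ?size_enum_ord // nth_ord_enum tnth_mktuple.
have size_t : size (sort <=%R t) = n by rewrite size_sort size_tuple.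
move=> i j ij; rewrite !entry.
apply: (sorted_leq_nth le_trans le_refl) => //; rewrite ?inE ?size_t //.
by apply: sort_sorted; exact: le_total.
Qed.

Lemma sum_col_perm {R : realType} {n} (m : 'rV[R]_n) (s : 'S_n) :
  \sum_j (col_perm s m) ord0 j = \sum_j m ord0 j.
Proof.
by rewrite [RHS](reindex_perm s); apply: eq_bigr => j _; rewrite mxE.
Qed.

(** If [f m > k], the ray from [m] along [d] stays in the plane and [f] only grows on it, so it
    never meets [C]. It is then an unbounded connected subset of the component of [m]. *)
Lemma enclosed_escape {R : realType} (C : set 'rV[R]_3)
    (f : 'rV[R]_3 -> R) (m d : 'rV[R]_3) (k e : R) :
  C `<=` plane (R := R) -> \sum_j d ord0 j = 0 -> 0 < e ->
  (forall t, f (m + t *: d) = f m + t * e) ->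
  (forall x, C x -> f x <= k) -> enclosed C m -> f m <= k.
Proof.
move=> C_plane d_sum e_gt0 f_ray f_C [/f_C //|[[m_plane mC] bnd]].
case: (leP (f m) k) => // fm; exfalso.
have d_neq0 : d != 0.
  apply: contraTneq e_gt0 => d0; have := f_ray 1.
  by rewrite d0 scaler0 addr0 mul1r => /eqP; rewrite -subr_eq0; lra.
pose ray t := m + t *: d.
pose A := ray @` `[0, +oo[%classic.
have A_comp : A `<=` connected_component (plane (R := R) `\` C) m.
  apply: connected_component_max.
  - by exists 0; rewrite /ray ?scale0r ?addr0 //= in_itv /= lexx.
  - move=> _ [t + <-]; rewrite /= in_itv /= andbT => t_ge0; split.
      rewrite /plane /=; under eq_bigr do rewrite !mxE.
      by rewrite big_split /= -mulr_sumr d_sum mulr0 addr0.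
    move=> /f_C; rewrite f_ray leNgt => /negP; apply.
    by apply: lt_le_trans fm _; rewrite lerDl mulr_ge0 // ltW.
  - apply: connected_continuous_connected.
      exact/connected_intervalP/interval_is_interval.
    apply: continuous_subspaceT => t; apply: cvgD; first exact: cvg_cst.
    by apply: cvgZl; exact: cvg_id.
have [M0 [_ bM0]] := bnd; pose M := M0 + 1.
have /bM0 /= bndM : M0 < M by rewrite ltrDl.
have d_gt0 : 0 < `|d| by rewrite normr_gt0.
(* Far enough that even after subtracting the norm of [m] the point has norm above [M]. *)
pose t := (`|M| + `|m| + 1) / `|d|.
have t_ge0 : 0 <= t by rewrite divr_ge0 ?addr_ge0.
have : `|ray t| <= M.
  by apply/bndM/A_comp; exists t => //=; rewrite in_itv /= t_ge0.
rewrite leNgt => /negP; apply.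
have : t * `|d| <= `|ray t| + `|m|.
  rewrite -{1}(ger0_norm t_ge0) -normrZ
    [X in _ <= X + _](_ : _ = `|t *: d + m|).
    by rewrite -{1}(addrK m (t *: d)) ler_normB.
  by rewrite /ray addrC.
rewrite /t divfK ?gt_eqF //; have := ler_norm M; lra.
Qed.

(** * The region cut out by the gauges is enclosed *)

Section Region.
Context {R : realType} {s1 s2 s3 : R} (adm : admissible s1 s2 s3).
Local Notation a := (u_alpha s1 s2 s3).
Local Notation b := (u_beta s1 s2 s3).

(** On the plane this is the middle entry; the formula makes its continuity follow from that of the
    extremes. *)
Definition row_mid (m : 'rV[R]_3) := 1 - row_min m - row_max m.

(* The last two keep [m] away from points such as (0, 0, 1), where both values
   of [H] vanish off Gamma. *)
Definition gauges (i : 'I_4) (m : 'rV[R]_3) : R :=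
  let Hm := H (row_min m) (row_mid m) (row_max m) in
  [:: Hm a; Hm b; row_min m; row_mid m - a]`_i.

Lemma gauges_continuous i : continuous (gauges i).
Proof.
have cmin := @row_min_continuous R 2; have cmax := @row_max_continuous R 2.
have cC (c : R) : continuous (fun _ : 'rV[R]_3 => c) by exact: cst_continuous.
have cD (f g : 'rV[R]_3 -> R) :
    continuous f -> continuous g -> continuous (fun m => f m + g m).
  by move=> cf cg m; apply: continuousD; [exact: cf | exact: cg].
have cB (f g : 'rV[R]_3 -> R) :
    continuous f -> continuous g -> continuous (fun m => f m - g m).
  by move=> cf cg m; apply: continuousB; [exact: cf | exact: cg].
have cM (f g : 'rV[R]_3 -> R) :
    continuous f -> continuous g -> continuous (fun m => f m * g m).
  by move=> cf cg m; apply: continuousM; [exact: cf | exact: cg].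
have cmid : continuous row_mid by apply/cB => //; apply/cB.
have cH u : continuous (fun m => H (row_min m) (row_mid m) (row_max m) u).
  have cmid2 : continuous (fun m => row_mid m ^+ 2) by exact/cM.
  rewrite /H; repeat first [exact: cC | exact: cmin | exact: cmax | exact: cmid
    | exact: cmid2 | apply/cB | apply/cD | apply/cM].
case: i => [[|[|[|[|i]]]] ilt] //=; rewrite /gauges /=.
- exact: cH.
- exact: cH.
- exact/cB.
Qed.

Lemma vec3_sorted (v : 'rV[R]_3) s : row_sorted v -> plane v ->
  let m := col_perm s v in
  [/\ v = vec3 (row_min m) (row_mid m) (row_max m),
      row_min m <= row_mid m & row_mid m <= row_max m].
Proof.
move=> v_sorted v_plane m.
rewrite /row_mid /m row_min_perm // row_max_perm //.
have midE : 1 - v ord0 ord0 - v ord0 ord_max = v ord0 (lift ord0 ord0).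
  rewrite -[1]v_plane !big_ord_recl big_ord0.
  rewrite (_ : lift ord0 (lift ord0 ord0) = ord_max); first by ring.
  exact/val_inj.
rewrite midE; split; try exact: v_sorted.
apply/rowP => j; rewrite mxE; case: j => [[|[|[|j]]] jlt] //=;
  by congr (v _ _); exact/val_inj.
Qed.

(** A zero of either value of [H] would place the point on [Gamma]; once both are positive, the two
    other inequalities become strict as well. This is what makes the region open off [Gamma]. *)
Lemma gauges_gt0 m : plane m -> ~ Gamma s1 s2 s3 m ->
  (forall i, 0 <= gauges i m) -> forall i, 0 < gauges i m.
Proof.
move=> m_plane mG ge0.
have := ge0 (@Ordinal 4 0 isT); have := ge0 (@Ordinal 4 1 isT).
have := ge0 (@Ordinal 4 2 isT); have := ge0 (@Ordinal 4 3 isT).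
rewrite /gauges /= subr_ge0 => mid_ge min_ge Hb Ha.
have [s [v [v_sorted mE]]] := sort_row m.
have v_plane : plane v by rewrite /plane /= -m_plane mE sum_col_perm.
have [] := vec3_sorted v s v_sorted v_plane; rewrite -mE => vE le12 le23.
have sum_m : row_min m + row_mid m + row_max m = 1 by rewrite /row_mid; ring.
have mid_gt0 : 0 < row_mid m by apply: lt_le_trans mid_ge; exact: alpha_gt0.
have Hneq0 : ~ (H (row_min m) (row_mid m) (row_max m) a = 0 \/
                H (row_min m) (row_mid m) (row_max m) b = 0).
  move=> H0; apply: mG; exists s => //; exists v; last by rewrite mE.
  by rewrite vE; exact: mem_Gamma.
have Ha' : 0 < H (row_min m) (row_mid m) (row_max m) a.
  by rewrite lt_neqAle Ha andbT eq_sym; apply/eqP => H0; apply: Hneq0; left.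
have Hb' : 0 < H (row_min m) (row_mid m) (row_max m) b.
  by rewrite lt_neqAle Hb andbT eq_sym; apply/eqP => H0; apply: Hneq0; right.
case=> [[|[|[|[|i]]]] ilt] //=.
- exact: (min_gt0 adm) mid_ge le23 sum_m Hb.
- by rewrite subr_gt0; apply: (mid_gt_alpha adm) Ha'.
Qed.

Lemma gauges_enclosed m : plane m -> (forall i, 0 <= gauges i m) ->
  L_set s1 s2 s3 m.
Proof.
move=> m_plane m_ge0.
have [mG|mG] := pselect (Gamma s1 s2 s3 m); first by left.
right; split=> //=.
set A := plane (R := R) `\` _; set C := connected_component A m.
have C_A : C `<=` A by exact: connected_component_sub.
pose E := \bigcap_(i in [set: 'I_4]) [set m | 0 <= gauges i m].
(* A nonempty relatively clopen subset of the connected set [C] is all of [C]: the strict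
   inequalities give openness, the weak ones closedness. *)
have CE : C `&` E = C.
  apply: (component_connected (A := A) (x := m)).
  - exists m; split; last by move=> i _; exact: m_ge0.
    exact: connected_component_refl.
  - exists [set m | forall i, 0 < gauges i m].
      rewrite openE => x x_gt0.
      suff : \forall y \near x, forall i, 0 < gauges i y by [].
      apply: (@filter_forall _ _ (fun i y => 0 < gauges i y)
        _ (nbhs_filter x)) => i.
      apply: open_nbhs_nbhs; split; last exact: x_gt0.
      apply: (@open_comp _ _ (gauges i) [set y | 0 < y]); last exact: open_gt.
      by move=> y _; exact: gauges_continuous.
    apply/seteqP; split=> x [xC x_in]; split=> // i; last first.
      by move=> _; exact/ltW/x_in.
    have [x_plane xG] := C_A _ xC.
    by apply: gauges_gt0 => // j; exact: x_in.
  - exists E => //; apply: closed_bigI => i _.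
    apply: (@preimage_closed _ _ (gauges i) [set x | 0 <= x]).
      by move=> x _; exact: gauges_continuous.
    exact: closed_ge.
(* Nonnegative entries of sum 1 are at most 1. *)
exists 1; split; first exact: num_real.
move=> M M_gt1 x; rewrite -CE => -[/C_A[x_plane _] xE].
apply: le_trans (ltW M_gt1).
rewrite [leLHS]/Num.Def.normr /= mx_normrE.
apply/bigmax_leP; split=> // -[i j] _ /=.
have x_ge0 k : 0 <= x ord0 k.
  apply: le_trans (xE (@Ordinal 4 2 isT) I) _; exact: bigmin_le.
by rewrite ord1 ger0_norm // -x_plane (bigD1 j) //= lerDl sumr_ge0.
Qed.

End Region.

(** * Half-planes containing the quadrilateral *)

Definition dot3 {R : realType} (c m : 'rV[R]_3) := \sum_j c ord0 j * m ord0 j.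

Lemma dot3E {R : realType} (c0 c1 c2 m0 m1 m2 : R) :
  dot3 (vec3 c0 c1 c2) (vec3 m0 m1 m2) = c0 * m0 + c1 * m1 + c2 * m2.
Proof.
by rewrite /dot3 !big_ord_recl big_ord0 !mxE /= addr0 addrA.
Qed.

Lemma plane_vec3 {R : realType} (m0 m1 m2 : R) :
  plane (vec3 m0 m1 m2) <-> m0 + m1 + m2 = 1.
Proof.
by rewrite /plane /= !big_ord_recl big_ord0 !mxE /= addr0 addrA.
Qed.

Lemma row3_vec3 {R : realType} (v : 'rV[R]_3) :
  exists x y z, v = vec3 x y z.
Proof.
exists (v ord0 ord0), (v ord0 (lift ord0 ord0)), (v ord0 ord_max).
apply/rowP => j; rewrite mxE; case: j => [[|[|[|j]]] jlt] //=;
  by congr (v _ _); exact/val_inj.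
Qed.

Lemma dot3_line {R : realType} (c x y : 'rV[R]_3) (p q : R) :
  dot3 c (p *: x + q *: y) = p * dot3 c x + q * dot3 c y.
Proof.
rewrite /dot3 !mulr_sumr -big_split; apply: eq_bigr => j _.
by rewrite !mxE /=; ring.
Qed.

Lemma segment_dot3_le0 {R : realType} (c x y : 'rV[R]_3) :
  dot3 c x <= 0 -> dot3 c y <= 0 ->
  forall z, segment x y z -> dot3 c z <= 0.
Proof.
move=> cx cy _ [t /= /andP[t_ge0 t_le1] <-]; rewrite dot3_line.
by rewrite -oppr_ge0 opprD -!mulrN addr_ge0 ?mulr_ge0 ?oppr_ge0 ?subr_ge0.
Qed.

Lemma segment_plane {R : realType} (x y : 'rV[R]_3) :
  plane x -> plane y -> segment x y `<=` plane (R := R).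
Proof.
move=> px py _ [t _ <-]; rewrite /plane /=; under eq_bigr do rewrite !mxE.
by rewrite big_split /= -!mulr_sumr px py; ring.
Qed.

Lemma quadrilateral_halfplane {R : realType} (A B C D : 'rV[R]_3)
    (c0 c1 c2 : R) : (c0 != c1) || (c1 != c2) ->
  plane A -> plane B -> plane C -> plane D ->
  (forall x, x \in [:: A; B; C; D] -> dot3 (vec3 c0 c1 c2) x <= 0) ->
  forall m, quadrilateral A B C D m -> dot3 (vec3 c0 c1 c2) m <= 0.
Proof.
move=> c_neq pA pB pC pD c_le0 m.
have [cA cB cC cD] : [/\ dot3 (vec3 c0 c1 c2) A <= 0,
    dot3 (vec3 c0 c1 c2) B <= 0, dot3 (vec3 c0 c1 c2) C <= 0 &
    dot3 (vec3 c0 c1 c2) D <= 0].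
  by split; apply: c_le0; rewrite !inE eqxx ?orbT.
(* Three times the projection of [c] onto the vectors of sum zero; [e] is its product with [c],
   positive as the functional is not constant on the plane. *)
pose d := vec3 (2 * c0 - c1 - c2) (2 * c1 - c0 - c2) (2 * c2 - c0 - c1).
pose e := (c0 - c1) ^+ 2 + (c1 - c2) ^+ 2 + (c2 - c0) ^+ 2.
apply: (@enclosed_escape _ _ (dot3 (vec3 c0 c1 c2)) m d 0 e).
- by move=> x [[[]|]|]; apply: segment_plane.
- by rewrite !big_ord_recl big_ord0 !mxE /=; ring.
- have [? ? ?] : [/\ 0 <= (c0 - c1) ^+ 2, 0 <= (c1 - c2) ^+ 2
      & 0 <= (c2 - c0) ^+ 2] by rewrite !sqr_ge0.
  case/orP: c_neq; rewrite -subr_eq0 -sqrf_eq0 => c_neq.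
    have : 0 < (c0 - c1) ^+ 2 by rewrite lt_neqAle eq_sym c_neq.
    rewrite /e; lra.
  have : 0 < (c1 - c2) ^+ 2 by rewrite lt_neqAle eq_sym c_neq.
  rewrite /e; lra.
- move=> t; rewrite -[X in dot3 _ (X + _)]scale1r dot3_line mul1r dot3E.
  by congr (_ + t * _); rewrite /e; ring.
- by move=> x [[[]|]|]; apply: segment_dot3_le0.
Qed.

Lemma quadrilateral_plane {R : realType} (A B C D : 'rV[R]_3) :
  plane A -> plane B -> plane C -> plane D ->
  quadrilateral A B C D `<=` plane (R := R).
Proof.
move=> pA pB pC pD m [[[[]|]|]|[[]]] //; exact: segment_plane.
Qed.

(** Each inequality of [chamber_cell] is the half-plane bounded by one side of the quadrilateral, so
    it suffices to test it at the four vertices. *)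
Lemma quadrilateral_cell {R : realType} (s1 s2 s3 x y z : R) :
  admissible s1 s2 s3 ->
  let va := s2 / (2 * s2 + s3) in
  let vb := s2 / (2 * s2 + s1) in
  quadrilateral (vec3 s1 s2 s3) (vec3 va va (1 - 2 * va))
    (vec3 (1 / 3) (1 / 3) (1 / 3)) (vec3 (1 - 2 * vb) vb vb) (vec3 x y z) ->
  chamber_cell s1 s2 s3 x y z.
Proof.
move=> [s1_gt0 lt12 lt23 sum_s] va vb Q.
have vaE : va * (2 * s2 + s3) = s2 by rewrite divfK // gt_eqF; lra.
have vbE : vb * (2 * s2 + s1) = s2 by rewrite divfK // gt_eqF; lra.
have va_gt0 : 0 < va by rewrite divr_gt0; lra.
have vb_gt0 : 0 < vb by rewrite divr_gt0; lra.
clearbody va vb.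
have va3 : va <= 1 / 3 by nra.
have vb3 : 1 / 3 <= vb by nra.
have pS : plane (vec3 s1 s2 s3) by apply/plane_vec3.
have pA : plane (vec3 va va (1 - 2 * va)) by apply/plane_vec3; ring.
have pC : plane (vec3 (1 / 3) (1 / 3) (1 / 3) : 'rV[R]_3).
  by apply/plane_vec3; field.
have pB : plane (vec3 (1 - 2 * vb) vb vb) by apply/plane_vec3; ring.
have half (c0 c1 c2 : R) : (c0 != c1) || (c1 != c2) ->
    c0 * s1 + c1 * s2 + c2 * s3 <= 0 ->
    c0 * va + c1 * va + c2 * (1 - 2 * va) <= 0 ->
    c0 * (1 / 3) + c1 * (1 / 3) + c2 * (1 / 3) <= 0 ->
    c0 * (1 - 2 * vb) + c1 * vb + c2 * vb <= 0 ->
    c0 * x + c1 * y + c2 * z <= 0.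
  move=> c_neq cS cA cC cB; rewrite -dot3E.
  apply: quadrilateral_halfplane c_neq pS pA pC pB _ _ Q => m.
  by rewrite !inE => /or4P[]/eqP->; rewrite dot3E; [exact: cS | exact: cA
    | exact: cC | exact: cB].
have xy : 1 * x + -1 * y + 0 * z <= 0.
  by apply/half; lra.
have yz : 0 * x + 1 * y + -1 * z <= 0.
  by apply/half; lra.
have zy : 0 * x + - s3 * y + s2 * z <= 0.
  by apply/half; nra.
have yx : - s2 * x + s1 * y + 0 * z <= 0.
  by apply/half; nra.
have /plane_vec3 sum_m := quadrilateral_plane _ _ _ _ pS pA pC pB _ Q.
split; lra.
Qed.

Theorem proposition5p10 (R : realType) (s1 s2 s3 : R)
  (s1_gt0 : 0 < s1) (s1_lt_s2 : s1 < s2) (s2_lt_s3 : s2 < s3)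
  (s_sum : s1 + s2 + s3 = 1) :
  L_MN s1 s2 s3 `<=` L_set s1 s2 s3.
Proof.
have adm : admissible s1 s2 s3 by [].
move=> _ [sigma _ [v vQ <-]].
have [x [y [z vE]]] := row3_vec3 v; rewrite vE in vQ *.
have cell := quadrilateral_cell _ _ _ _ _ _ adm vQ.
have [x_gt0 y_gt0] := cell_gt0 adm _ _ _ cell.
have [le_xy le_yz sum_m _ _] := cell.
have v_sorted : row_sorted (vec3 x y z) by exact: sorted_vec3.
have v_plane : plane (vec3 x y z) by apply/plane_vec3.
(* The gauges depend only on the ordered entries, so [sigma] disappears and the cell estimates
   apply. *)
apply: (gauges_enclosed adm); first by rewrite /plane /= sum_col_perm.
have [mE _ _] := vec3_sorted _ sigma v_sorted v_plane.
set m := col_perm _ _ in mE *.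
have [xE yE zE] : [/\ row_min m = x, row_mid m = y & row_max m = z].
  have coord j : vec3 x y z ord0 j = _ :=
    congr1 (fun w : 'rV[R]_3 => w ord0 j) mE.
  have := coord ord0; have := coord (lift ord0 ord0); have := coord ord_max.
  by rewrite !mxE /= => <- <- <-.
have a_gt0 := alpha_gt0 adm; have [ltab HF] := H_factor adm.
have Ha : 0 <= H x y z (u_alpha s1 s2 s3).
  apply: (H_cell_ge0 adm) cell => //; first exact: same_side_alpha.
  by rewrite HF subrr mulr0 mul0r.
have Hb : 0 <= H x y z (u_beta s1 s2 s3).
  apply: (H_cell_ge0 adm) cell => //; [exact: lt_trans ltab
    | exact: same_side_beta | by rewrite HF subrr mulr0].
case=> [[|[|[|[|i]]]] ilt] //=; rewrite /gauges /= ?xE ?yE ?zE //.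
  exact: ltW.
by rewrite subr_ge0; apply: (mid_ge_alpha adm) Ha.
Qed.
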